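(* Let $m>n$ be relatively prime positive integers, and suppose that $m$ is neither an odd perfect cube nor twice a perfect cube. Let $r = n(m-n)$ and $s = m(m+n)$, and let $\mathcal{C}_{m,n}$ be the elliptic curve given by the projective closure of $$s(xy - r^2) = x^2 y + x y^2,$$ with group law on its points in which the identity is $[1,-1,0]$ and $P+Q$ is the reflection in the line $y=x$ of the third intersection point of the curve with the line through $P$ and $Q$ (tangent line if $P=Q$). Then the group $\mathcal{C}_{m,n}(\mathbb{Q})$ of rational points satisfies $$\operatorname{rank}_{\mathbb{Z}} \mathcal{C}_{m,n}(\mathbb{Q}) \geq 1 .$$
   Context: For such $m,n$, the numbers $m^2-n^2$, $2mn$, $m^2+n^2$ are the side lengths of a right triangle with inradius $r=n(m-n)$ and semiperimeter $s=m(m+n)$; since this triangle is not equilateral one has $s>3\sqrt{3}r>0$, so the cubic above is nonsingular. The rank of $\mathcal{C}_{m,n}(\mathbb{Q})$ is its rank as a finitely generated abelian group. *)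

(* Defs.v *)
From mathcomp Require Import all_boot all_order all_algebra.
Set Implicit Arguments. Unset Strict Implicit. Unset Printing Implicit Defensive.
Import Order.TTheory GRing.Theory Num.Theory.
Local Open Scope ring_scope.

(* homogeneous coordinates [X, Y, Z] (nonzero triples represent points) *)
Definition pt := (rat * rat * rat)%type.

Definition ptX (p : pt) : rat := p.1.1.
Definition ptY (p : pt) : rat := p.1.2.
Definition ptZ (p : pt) : rat := p.2.

Definition mkpt (x y z : rat) : pt := (x, y, z).
Definition pt0 : pt := mkpt 0 0 0.
Definition ptadd (p q : pt) : pt := mkpt (ptX p + ptX q) (ptY p + ptY q) (ptZ p + ptZ q).
Definition ptscale (c : rat) (p : pt) : pt := mkpt (c * ptX p) (c * ptY p) (c * ptZ p).
Definition ptsub (p q : pt) : pt := ptadd p (ptscale (-1) q).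
Definition dot (p q : pt) : rat := ptX p * ptX q + ptY p * ptY q + ptZ p * ptZ q.
Definition cross (p q : pt) : pt :=
  mkpt (ptY p * ptZ q - ptZ p * ptY q)
       (ptZ p * ptX q - ptX p * ptZ q)
       (ptX p * ptY q - ptY p * ptX q).

Definition proj_eq (p q : pt) : bool := cross p q == pt0.

(* homogenization of  s (x y - r^2) = x^2 y + x y^2 :
   F(X,Y,Z) = s (X Y Z - r^2 Z^3) - X^2 Y - X Y^2 *)
Definition Fc (s r : rat) (p : pt) : rat :=
  let X := ptX p in let Y := ptY p in let Z := ptZ p in
  s * (X * Y * Z - r ^+ 2 * Z ^+ 3) - X ^+ 2 * Y - X * Y ^+ 2.

Definition gradF (s r : rat) (p : pt) : pt :=
  let X := ptX p in let Y := ptY p in let Z := ptZ p in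
  mkpt (s * Y * Z - 2 * X * Y - Y ^+ 2)
       (s * X * Z - X ^+ 2 - 2 * X * Y)
       (s * X * Y - 3 * s * r ^+ 2 * Z ^+ 2).

Definition on_curve (s r : rat) (p : pt) : bool := (p != pt0) && (Fc s r p == 0).

(* Third intersection point of the curve with the line through p and q
   (tangent line if p = q).  For p, q on the curve, F(a p + b q) =
   a b (a (grad F(p).q) + b (grad F(q).p)), whence the chord formula;
   in the tangent case, q' := grad F(p) x p is a second point of the
   tangent line and F(a p + b q') = b^2 (a (grad F(q').p) + b F(q')). *)
Definition third (s r : rat) (p q : pt) : pt :=
  if proj_eq p q then
    let q' := cross (gradF s r p) p in
    ptsub (ptscale (Fc s r q') p) (ptscale (dot (gradF s r q') p) q')
  else
    ptsub (ptscale (dot (gradF s r q) p) p) (ptscale (dot (gradF s r p) q) q).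

Definition refl (p : pt) : pt := mkpt (ptY p) (ptX p) (ptZ p).

Definition Opt : pt := mkpt 1 (-1) 0.

Definition cadd (s r : rat) (p q : pt) : pt := refl (third s r p q).

Definition cneg (p : pt) : pt := refl p.

Fixpoint cmul (s r : rat) (n : nat) (p : pt) : pt :=
  if n is k.+1 then cadd s r p (cmul s r k p) else Opt.

Definition czmul (s r : rat) (z : int) (p : pt) : pt :=
  match z with
  | Posz k => cmul s r k p
  | Negz k => cmul s r k.+1 (cneg p)
  end.

Definition ccomb (s r : rat) (cs : seq int) (ps : seq pt) : pt :=
  foldr (fun cp acc => cadd s r (czmul s r cp.1 cp.2) acc) Opt (zip cs ps).

Definition rank_ge (s r : rat) (k : nat) : Prop :=
  exists ps : seq pt,
    size ps = k /\ all (on_curve s r) ps /\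
    forall cs : seq int, size cs = k -> has (fun c => c != 0) cs ->
      ~~ proj_eq (ccomb s r cs ps) Opt.

(* Main.v *)
Require Import Defs.
From mathcomp Require Import all_boot all_order all_algebra.
From mathcomp Require Import ring lra zify.
Import Order.TTheory GRing.Theory Num.Theory.
Local Open Scope ring_scope.

(** With W = s Z - X - Y the curve reads X Y W = s r^2 Z^3; ordering s - a,
    s - b, s - c for the triangle with sides a, b, c suitably gives a rational
    point P.  Suppose k P = O with k > 0 minimal.

    If k = 2 j then j P is a rational point of order 2, that is x = y and
    s (x^2 - r^2) = 2 x^3; comparing prime factors, m would be an odd cube or
    twice a cube.

    If k is odd, work at the prime 2.  When m and n are both odd the curve is,
    up to the scaling (x, y) -> (2 x, 2 y), the one attached to (m + n) / 2 and
    (m - n) / 2, which have opposite parities.  So write s = dl a (a + b) and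
    r = dl b (a - b) with a, b of opposite parities.  If a is even the curve has
    additive reduction with nonsingular part Z/2, and P reduces to the
    nontrivial class; if a is odd the reduction is multiplicative and P lies on
    the component of order two.  In both cases the odd multiples of P stay off
    the identity. *)

(** * Lines and the cubic *)

Definition lin (a : rat) (p : pt) (b : rat) (q : pt) : pt :=
  ptadd (ptscale a p) (ptscale b q).
(** The derivative of F at [p] in the direction [q]; for a smooth [p] on the curve it vanishes
    exactly when [q] is on the tangent at [p]. *)
Definition polar (s r : rat) (p q : pt) : rat := dot (gradF s r p) q.
(** [proj_eq] holds against the zero triple and so is not transitive; [sim] is an equivalence
    relation on all triples. *)
Definition sim (p q : pt) : Prop := exists2 k : rat, k != 0 & q = ptscale k p.

Ltac coords :=
  rewrite /lin /polar /ptsub /ptadd /ptscale /cross /dot /gradF /Fc /refl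
    /pt0 /mkpt /ptX /ptY /ptZ /=.

Lemma pt_eq0 (x y z : rat) : ((x, y, z) == pt0) = [&& x == 0, y == 0 & z == 0].
Proof. by rewrite /pt0 /mkpt !xpair_eqE andbA. Qed.

Lemma pt_ext (x y z x' y' z' : rat) :
  x = x' -> y = y' -> z = z' -> (x, y, z) = (x', y', z').
Proof. by move=> -> -> ->. Qed.

Lemma Fc_lin s r p q a b :
  Fc s r (lin a p b q) = a ^+ 3 * Fc s r p + a ^+ 2 * b * polar s r p q
     + a * b ^+ 2 * polar s r q p + b ^+ 3 * Fc s r q.
Proof. by case: p => [[x y] z]; case: q => [[u v] w]; coords; ring. Qed.

Lemma polar_lin_r s r p d a b :
  polar s r p (lin a p b d) = 3 * a * Fc s r p + b * polar s r p d.
Proof. by case: p => [[x y] z]; case: d => [[u v] w]; coords; ring. Qed.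

Lemma polar_lin_l s r p d a b :
  polar s r (lin a p b d) p =
  3 * a ^+ 2 * Fc s r p + 2 * a * b * polar s r p d + b ^+ 2 * polar s r d p.
Proof. by case: p => [[x y] z]; case: d => [[u v] w]; coords; ring. Qed.

Lemma cross_lin_r p d a b : cross p (lin a p b d) = ptscale b (cross p d).
Proof.
by case: p => [[x y] z]; case: d => [[u v] w]; coords; apply: pt_ext; ring.
Qed.

Lemma ptscale_eq0 k p : (ptscale k p == pt0) = (k == 0) || (p == pt0).
Proof.
case: p => [[x y] z]; rewrite /ptscale /mkpt /ptX /ptY /ptZ /= !pt_eq0 !mulf_eq0.
by case: (k == 0).
Qed.

Lemma ptscaleA k l p : ptscale k (ptscale l p) = ptscale (k * l) p.
Proof. by case: p => [[x y] z]; coords; apply: pt_ext; ring. Qed.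

Lemma ptscale1 p : ptscale 1 p = p.
Proof. by case: p => [[x y] z]; coords; apply: pt_ext; ring. Qed.

Lemma sim_refl p : sim p p.
Proof. by exists 1; rewrite ?oner_eq0 ?ptscale1. Qed.

Lemma sim_sym p q : sim p q -> sim q p.
Proof.
move=> [k k0 ->]; exists k^-1; first by rewrite invr_eq0.
by rewrite ptscaleA mulVf // ptscale1.
Qed.

Lemma sim_trans p q t : sim p q -> sim q t -> sim p t.
Proof.
move=> [k k0 ->] [l l0 ->]; exists (l * k); first by rewrite mulf_neq0.
by rewrite ptscaleA.
Qed.

Lemma proj_eq_scale p q : p != pt0 -> proj_eq p q -> exists k, q = ptscale k p.
Proof.
case: p => [[x y] z]; case: q => [[u v] w]; rewrite pt_eq0 => p0.
rewrite /proj_eq /cross /mkpt /ptX /ptY /ptZ /= pt_eq0 => /and3P[/eqP e1 /eqP e2 /eqP e3].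
have [x0|x0] := eqVneq x 0; last first.
  by exists (u / x); coords; apply: pt_ext; apply: (mulfI x0); rewrite mulrA [x * (_ / _)]mulrC divfK //; lra.
have [y0|y0] := eqVneq y 0; last first.
  by exists (v / y); coords; apply: pt_ext; apply: (mulfI y0); rewrite mulrA [y * (_ / _)]mulrC divfK //; lra.
have z0 : z != 0 by move: p0; rewrite x0 y0 eqxx.
by exists (w / z); coords; apply: pt_ext; apply: (mulfI z0); rewrite mulrA [z * (_ / _)]mulrC divfK //; lra.
Qed.

Lemma proj_eq_sim p q : p != pt0 -> q != pt0 -> proj_eq p q -> sim p q.
Proof.
move=> p0 q0 /(proj_eq_scale _ _ p0)[k e]; exists k => //.
by apply: contraNneq q0 => k0; rewrite e ptscale_eq0 k0 eqxx.
Qed.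

Lemma sim_proj_eq p q : sim p q -> proj_eq p q.
Proof.
move=> [k _ ->]; case: p => [[x y] z].
by rewrite /proj_eq; coords; apply/eqP; apply: pt_ext; ring.
Qed.

Lemma dot_eq0 p : (dot p p == 0) = (p == pt0).
Proof.
case: p => [[x y] z]; rewrite pt_eq0 /dot /ptX /ptY /ptZ /= -!expr2.
by rewrite !paddr_eq0 ?addr_ge0 ?sqr_ge0 // !expf_eq0 /= andbA.
Qed.

(* The second tangent point is g x p for g the gradient; as g is a multiple of
   p x d, it lies on the line through p and d, off p because p.p <> 0 over Q. *)
Lemma tangent_point s r p d :
  Fc s r p = 0 -> gradF s r p != pt0 -> cross p d != pt0 -> polar s r p d = 0 ->
  exists a b, b != 0 /\ cross (gradF s r p) p = lin a p b d.
Proof.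
move=> Fp g0 c0 G0.
have gp : dot (gradF s r p) p = 0.
  transitivity (3 * Fc s r p); last by rewrite Fp mulr0.
  by case: p {Fp g0 c0 G0} => [[x y] z]; coords; ring.
have p0 : p != pt0.
  apply: contraNneq c0 => ->; case: d {G0} => [[u v] w].
  by rewrite /cross /pt0 /mkpt /ptX /ptY /ptZ /= pt_eq0 !mul0r subrr eqxx.
move: G0; rewrite /polar; move: (gradF s r p) g0 gp => g g0 gp gd.
have /(proj_eq_scale _ _ g0)[k ck] : proj_eq g (cross p d).
  rewrite /proj_eq; apply/eqP.
  transitivity (lin (dot g d) p (- dot g p) d); last first.
    rewrite gd gp; case: p d {Fp c0 p0 gp gd} => [[x y] z] [[u v] w].
    by coords; apply: pt_ext; ring.
  case: g p d {g0 gp gd Fp c0 p0} => [[g1 g2] g3] [[x y] z] [[u v] w].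
  by coords; apply: pt_ext; ring.
have k0 : k != 0 by apply: contraNneq c0 => k0; rewrite ck k0 ptscale_eq0 eqxx.
exists (- dot p d / k), (dot p p / k); split.
  by rewrite mulf_neq0 ?invr_eq0 ?dot_eq0.
transitivity (ptscale k^-1 (cross (ptscale k g) p)).
  case: g p {ck g0 gp gd Fp c0 p0} => [[g1 g2] g3] [[x y] z].
  by coords; apply: pt_ext; field.
rewrite -ck; case: p d {ck gp gd Fp c0 p0} => [[x y] z] [[u v] w].
by coords; apply: pt_ext; field.
Qed.

(* F(x p + y d) = y (b x - a y) (al x + be y), so the roots (1 : 0), (a : b)
   and (be : - al) are the three intersection points of the line with the cubic. *)
Lemma third_residual s r p d a b al be :
  Fc s r p = 0 -> gradF s r p != pt0 -> cross p d != pt0 ->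
  (a != 0) || (b != 0) ->
  al * b = polar s r p d -> - a * be = Fc s r d ->
  b * be - a * al = polar s r d p ->
  sim (third s r p (lin a p b d)) (lin be p (- al) d).
Proof.
move=> Fp g0 c0 ab0 eG eF eD; apply: sim_sym; rewrite /third {1}/proj_eq cross_lin_r.
have {1}-> : (ptscale b (cross p d) == pt0) = (b == 0).
  by rewrite ptscale_eq0 (negPf c0) orbF.
have [b0|b0] := eqVneq b 0; last first.
  exists (b ^+ 3); first by rewrite expf_neq0.
  rewrite -/(polar s r _ _) -/(polar s r _ _) polar_lin_l polar_lin_r Fp -eG -eD.
  case: p d {Fp g0 c0 eG eF eD} => [[x y] z] [[u v] w].
  by coords; apply: pt_ext; ring.
move: ab0 eG eD; rewrite b0 eqxx orbF mulr0 mul0r sub0r => a0 /esym eG eD.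
(* Here b = 0, so the second point is [p] up to scale and [third] works with a second point x p + y
   d of the tangent. *)
have [x [y [y0 ->]]] := tangent_point s r p d Fp g0 c0 eG.
exists (- a * y ^+ 3); first by rewrite mulf_neq0 ?oppr_eq0 ?expf_neq0.
have -> : dot (gradF s r (lin x p y d)) p = - (y ^+ 2 * a * al).
  by rewrite -/(polar s r _ _) polar_lin_l Fp eG -eD; ring.
rewrite Fc_lin Fp eG -eD -eF.
case: p d {Fp g0 c0 eG eF eD} => [[x1 y1] z1] [[u v] w].
by coords; apply: pt_ext; ring.
Qed.

(** * Compatibility of the third point with scaling *)

Lemma gradF_scale s r k p : gradF s r (ptscale k p) = ptscale (k ^+ 2) (gradF s r p).
Proof. by case: p => [[x y] z]; coords; apply: pt_ext; ring. Qed.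

Lemma Fc_scale s r k p : Fc s r (ptscale k p) = k ^+ 3 * Fc s r p.
Proof. by case: p => [[x y] z]; coords; ring. Qed.

Lemma third_scale_r s r p q k : k != 0 ->
  sim (third s r p q) (third s r p (ptscale k q)).
Proof.
move=> k0; rewrite /third.
have -> : proj_eq p (ptscale k q) = proj_eq p q.
  rewrite /proj_eq -[RHS]orFb -(negPf k0) -ptscale_eq0; congr (_ == _).
  by case: p q => [[x y] z] [[u v] w]; coords; apply: pt_ext; ring.
case: ifP => _; first exact: sim_refl.
exists (k ^+ 2); first by rewrite expf_neq0.
by case: p q => [[x y] z] [[u v] w]; coords; apply: pt_ext; ring.
Qed.

Lemma third_scale_l s r p q k : k != 0 ->
  sim (third s r p q) (third s r (ptscale k p) q).
Proof.
move=> k0; rewrite /third.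
have -> : proj_eq (ptscale k p) q = proj_eq p q.
  rewrite /proj_eq -[RHS]orFb -(negPf k0) -ptscale_eq0; congr (_ == _).
  by case: p q => [[x y] z] [[u v] w]; coords; apply: pt_ext; ring.
case: ifP => _.
  (* The second tangent point scales by k^3, so F there scales by k^9 and the gradient by k^6; both
     terms acquire k^10. *)
  exists (k ^+ 10); first by rewrite expf_neq0.
  have -> : cross (gradF s r (ptscale k p)) (ptscale k p)
            = ptscale (k ^+ 3) (cross (gradF s r p) p).
    rewrite gradF_scale; move: (gradF s r p) => g; case: g p => [[g1 g2] g3] [[x y] z].
    by coords; apply: pt_ext; ring.
  move: (cross _ _) => q'; rewrite Fc_scale gradF_scale.
  move: (gradF s r q') (Fc s r q') => g f.
  by case: g p q' => [[g1 g2] g3] [[x y] z] [[u v] w]; coords; apply: pt_ext; ring.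
exists (k ^+ 2); first by rewrite expf_neq0.
by case: p q => [[x y] z] [[u v] w]; coords; apply: pt_ext; ring.
Qed.

Lemma sim_third s r p p' q q' : sim p p' -> sim q q' ->
  sim (third s r p q) (third s r p' q').
Proof.
move=> [k k0 ->] [l l0 ->].
by apply: sim_trans (third_scale_l _ _ _ _ _ k0) (third_scale_r _ _ _ _ _ l0).
Qed.

Lemma refl_sim p q : sim p q -> sim (refl p) (refl q).
Proof. by move=> [k k0 ->]; exists k. Qed.

Lemma reflK p : refl (refl p) = p.
Proof. by case: p => [[x y] z]. Qed.

(** * Smoothness and absence of lines *)

Lemma three_not_square (q : rat) : q ^+ 2 != 3.
Proof.
apply/eqP => q2.
have d0 : (denq q)%:~R != 0 :> rat by rewrite intr_eq0 denq_neq0.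
have e : numq q ^+ 2 = 3 * denq q ^+ 2.
  apply/eqP; rewrite -(eqr_int rat) !expr2 !intrM; apply/eqP.
  by rewrite -[3%:~R]q2 -{3}[q]divq_num_den; field.
have {e} : (`|numq q| ^ 2 = 3 * `|denq q| ^ 2)%N by rewrite -!abszX e abszM.
have : (0 < `|denq q|)%N by rewrite absz_gt0 denq_neq0.
move: `|numq q|%N `|denq q|%N => a b b0 e.
have := congr1 (logn 3) e.
by rewrite lognM ?expn_gt0 ?b0 // !lognX (@logn_prime 3 3) //; lia.
Qed.

(** At Z = 0 vanishing partials force X = Y = 0. Elsewhere X and Y are nonzero, the first two
    partials give X = Y and s Z = 3 X, and the third gives X^2 = 3 r^2 Z^2, so s^2 = 27 r^2. *)
Lemma gradF_neq0 s r p : s != 0 -> r != 0 -> s ^+ 2 != 27 * r ^+ 2 ->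
  on_curve s r p -> gradF s r p != pt0.
Proof.
case: p => [[x y] z] s0 r0 sr /andP[p0 /eqP]; rewrite /Fc /ptX /ptY /ptZ /= => eF.
apply/negP; rewrite /gradF /mkpt /ptX /ptY /ptZ /= pt_eq0 => /and3P[/eqP e1 /eqP e2 /eqP e3].
have [z0|z0] := eqVneq z 0.
  move: p0; rewrite pt_eq0 z0 eqxx andbT.
  have xy : x * y = 0 by apply: (mulfI s0); move: e3; rewrite z0 => ?; lra.
  have /eqP : x ^+ 2 = 0 by move: e2; rewrite z0 => ?; lra.
  have /eqP : y ^+ 2 = 0 by move: e1; rewrite z0 => ?; lra.
  by rewrite !expf_eq0 /= => -> ->.
have nz : s * r ^+ 2 * z ^+ 3 != 0 by rewrite !mulf_neq0 ?expf_neq0.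
have x0 : x != 0 by apply: contraNneq nz => x0; rewrite x0 in eF; apply/eqP; lra.
have y0 : y != 0 by apply: contraNneq nz => y0; rewrite y0 in eF; apply/eqP; lra.
have a1 : s * z - 2 * x - y = 0 by apply: (mulfI y0); lra.
have a2 : s * z - x - 2 * y = 0 by apply: (mulfI x0); lra.
have exy : y = x by lra.
have esz : s * z = 3 * x by lra.
move: e3; rewrite exy => e3.
have e4 : x ^+ 2 = 3 * r ^+ 2 * z ^+ 2 by apply: (mulfI s0); lra.
case/eqP: sr; apply: (mulIf (x := z ^+ 2)); first by rewrite expf_neq0.
rewrite -exprMn esz exprMn e4; ring.
Qed.

(** If F(i, j, 0) = 0 then i j (i + j) = 0, so X, Y or W is constant on the line; the t^2
    coefficient makes that constant 0, against X Y W = s r^2 at Z = 1. *)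
Lemma no_line_affine s r x y i j : s != 0 -> r != 0 -> (i, j, 0) != pt0 ->
  (forall t, Fc s r (x + t * i, y + t * j, 1) = 0) -> Fc s r (i, j, 0) != 0.
Proof.
move=> s0 r0; rewrite pt_eq0 eqxx andbT => ij0 h.
have c0 : s * r ^+ 2 != 0 by rewrite mulf_neq0 ?expf_neq0.
move: (h 0) (h 1) (h (-1)); rewrite /Fc /ptX /ptY /ptZ /= => h0 h1 h2.
apply/negP => /eqP e.
have {e} /eqP : i * j * (i + j) = 0 by lra.
rewrite !mulf_eq0 -orbA => /or3P[] /eqP e.
- have j0 : j ^+ 2 != 0 by rewrite expf_neq0 //; move: ij0; rewrite e eqxx.
  have x0 : x = 0 by apply: (mulIf j0); rewrite e in h1 h2; lra.
  by case/eqP: c0; rewrite x0 in h0; lra.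
- have i0 : i ^+ 2 != 0 by rewrite expf_neq0 //; move: ij0; rewrite e eqxx andbT.
  have y0 : y = 0 by apply: (mulIf i0); rewrite e in h1 h2; lra.
  by case/eqP: c0; rewrite y0 in h0; lra.
have ej : j = - i by lra.
have i0 : i ^+ 2 != 0.
  by rewrite expf_neq0 //; move: ij0; rewrite ej oppr_eq0 andbb.
have w0 : s - x - y = 0 by apply: (mulIf i0); rewrite ej in h1 h2; lra.
have es : s = x + y by lra.
by case/eqP: c0; rewrite es in h0 *; lra.
Qed.

(** If all four coefficients in [Fc_lin] vanish, the whole line lies on the cubic. A finite point on
    it leads to [no_line_affine]; otherwise the line is Z = 0. *)
Lemma no_line s r p d : s != 0 -> r != 0 -> cross p d != pt0 ->
  Fc s r p = 0 -> polar s r p d = 0 -> polar s r d p = 0 -> Fc s r d != 0.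
Proof.
move=> s0 r0 c0 Fp G D; apply/negP => /eqP Fd.
have h x y : Fc s r (lin x p y d) = 0.
  by rewrite Fc_lin Fp G D Fd !mulr0 !addr0.
case: p d c0 h {Fp G D Fd} => [[x y] z] [[u v] w] c0 h.
have [z0|z0] := eqVneq z 0; last first.
  have hd : (u - w / z * x, v - w / z * y, 0) != pt0.
    apply: contraNN c0; rewrite /cross /mkpt /ptX /ptY /ptZ /= !pt_eq0 eqxx andbT.
    case/andP => /eqP a /eqP b; have -> : u = w / z * x by lra.
    have -> : v = w / z * y by lra.
    by apply/and3P; split; apply/eqP; field.
  have /(_ _) /negP := no_line_affine s r (x / z) (y / z) _ _ s0 r0 hd.
  apply.
    move=> t; apply: etrans (h ((1 - t * w) / z) t); congr Fc; coords.
    by apply: pt_ext; field.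
  apply/eqP; apply: etrans (h (- w / z) 1); congr Fc; coords.
  by apply: pt_ext; field.
rewrite z0 in c0 h.
have [w0|w0] := eqVneq w 0; last first.
  have hd : (x, y, 0) != pt0.
    apply: contraNN c0; rewrite /cross /mkpt /ptX /ptY /ptZ /= !pt_eq0 eqxx andbT.
    case/andP => /eqP -> /eqP ->.
    by apply/and3P; split; apply/eqP; ring.
  have /(_ _) /negP := no_line_affine s r (u / w) (v / w) _ _ s0 r0 hd.
  apply.
    move=> t; apply: etrans (h t w^-1); congr Fc; coords.
    by apply: pt_ext; field.
  by apply/eqP; apply: etrans (h 1 0); congr Fc; coords; apply: pt_ext; ring.
rewrite w0 in c0 h.
have e0 : x * v - y * u != 0.
  apply: contraNN c0; rewrite /cross /mkpt /ptX /ptY /ptZ /= !pt_eq0 => ->.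
  by rewrite !(mulr0, mul0r) subrr eqxx.
(* Cramer's rule writes (1, 1, 0) in terms of the two points at infinity, and F is -2 there. *)
have := h ((v - u) / (x * v - y * u)) ((x - y) / (x * v - y * u)).
have -> : lin ((v - u) / (x * v - y * u)) (x, y, 0) ((x - y) / (x * v - y * u)) (u, v, 0) = (1, 1, 0).
  by coords; apply: pt_ext; field.
by rewrite /Fc /ptX /ptY /ptZ /=; lra.
Qed.

(** * Cancellation and torsion *)

Definition nonsingular (s r : rat) : bool :=
  [&& s != 0, r != 0 & s ^+ 2 != 27 * r ^+ 2].

Lemma sim_on_curve s r p q : sim p q -> on_curve s r p -> on_curve s r q.
Proof.
move=> [k k0 ->] /andP[p0 /eqP Fp].
by rewrite /on_curve ptscale_eq0 negb_or k0 p0 Fc_scale Fp mulr0 eqxx.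
Qed.

Lemma lin_neq0 p d a b : cross p d != pt0 -> (a != 0) || (b != 0) ->
  lin a p b d != pt0.
Proof.
move=> c0; have [b0|b0 _] := eqVneq b 0; last first.
  apply: contraNneq c0 => e; have := cross_lin_r p d a b.
  rewrite e => /esym/eqP.
  have -> : cross p pt0 = pt0.
    by case: p {e} => [[x y] z]; coords; apply: pt_ext; ring.
  by rewrite ptscale_eq0 (negPf b0).
rewrite orbF b0 => a0; have -> : lin a p 0 d = ptscale a p.
  by case: p d {c0} => [[x y] z] [[u v] w]; coords; apply: pt_ext; ring.
rewrite ptscale_eq0 (negPf a0) /=; apply: contraNneq c0 => ->.
by case: d => [[u v] w]; coords; apply/eqP; apply: pt_ext; ring.
Qed.

(** The line meets the cubic in [p], [q] and a third point, so joining [p] to the third point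
    returns [q]. The torsion arguments rest on this cancellation. *)
Lemma third_cancel s r p q : nonsingular s r -> on_curve s r p -> on_curve s r q ->
  on_curve s r (third s r p q) /\ sim (third s r p (third s r p q)) q.
Proof.
move=> /and3P[s0 r0 sr] pC qC.
have g0 := gradF_neq0 s r p s0 r0 sr pC.
have [[p0 /eqP Fp] [q0 /eqP Fq]] := (andP pC, andP qC).
(* [d] spans the line together with [p]: it is [q] for a chord and the second tangent point
   otherwise; [a], [b] are the coordinates of [q]. [no_line] keeps [be] and [al] from both
   vanishing. *)
have [d [a [b [al [be [[c0 ab0 alb0] [[eG eF eD] qE]]]]]]] : exists d a b al be,
    [/\ cross p d != pt0, (a != 0) || (b != 0) & (be != 0) || (- al != 0)] /\
    [/\ al * b = polar s r p d, - a * be = Fc s r d & b * be - a * al = polar s r d p]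
    /\ sim q (lin a p b d).
  have [pq|pq] := boolP (proj_eq p q); last first.
    exists q, 0, 1, (polar s r p q), (polar s r q p); split; split => //=.
    - rewrite -negb_and oppr_eq0; apply/negP => /andP[/eqP D /eqP G].
      by move: (no_line s r p q s0 r0 pq Fp G D); rewrite Fq eqxx.
    - by split; [ring | rewrite Fq; ring | ring].
    have -> : lin 0 p 1 q = q; last exact: sim_refl.
    by case: p q {pq pC qC g0 p0 Fp q0 Fq} => [[x y] z] [[u v] w]; coords; apply: pt_ext; ring.
  set d := cross (gradF s r p) p.
  have gp : dot (gradF s r p) p = 0.
    transitivity (3 * Fc s r p); last by rewrite Fp mulr0.
    by case: p {pC g0 p0 Fp pq d} => [[x y] z]; coords; ring.
  have c0 : cross p d != pt0.
    have -> : cross p d = ptscale (dot p p) (gradF s r p).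
      transitivity (lin (dot p p) (gradF s r p) (- dot (gradF s r p) p) p).
        rewrite /d; move: (gradF s r p) => g.
        case: g p {pC g0 p0 Fp gp pq d} => [[x y] z] [[u v] w].
        by coords; apply: pt_ext; ring.
      rewrite gp; move: (gradF s r p) => g.
      case: g p {pC g0 p0 Fp gp pq d} => [[x y] z] [[u v] w].
      by coords; apply: pt_ext; ring.
    by rewrite ptscale_eq0 dot_eq0 negb_or p0.
  have G : polar s r p d = 0.
    rewrite /polar /d; move: (gradF s r p) => g.
    case: g p {pC g0 p0 Fp gp pq c0 d} => [[x y] z] [[u v] w].
    by coords; ring.
  exists d, 1, 0, (- polar s r d p), (- Fc s r d); split; split => //=.
  - rewrite -negb_and opprK oppr_eq0; apply/negP => /andP[/eqP F0 /eqP D].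
    by move: (no_line s r p d s0 r0 c0 Fp G D); rewrite F0 eqxx.
  - by split; [rewrite G; ring | ring | ring].
  apply: sim_trans (sim_sym _ _ (proj_eq_sim _ _ p0 q0 pq)) _.
  have -> : lin 1 p 0 d = p; last exact: sim_refl.
  move: d {c0 G} => d; case: p d {pC g0 p0 Fp gp pq} => [[x y] z] [[u v] w].
  by coords; apply: pt_ext; ring.
have R := third_residual s r p d a b al be Fp g0 c0 ab0 eG eF eD.
have {}R := sim_trans _ _ _ (sim_third s r _ _ _ _ (sim_refl p) qE) R.
split.
  apply: sim_on_curve (sim_sym _ _ R) _.
  rewrite /on_curve lin_neq0 //= Fc_lin Fp -eG -eF -eD; apply/eqP; ring.
apply: sim_trans (sim_third s r _ _ _ _ (sim_refl p) R) _.
apply: sim_trans (sim_sym _ _ qE).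
(* The residual formula is an involution: the coordinates (a, b) and (be, - al) trade places. *)
have := third_residual s r p d be (- al) (- b) a Fp g0 c0 alb0; rewrite opprK.
by apply; rewrite -?eG -?eF -?eD; ring.
Qed.

Lemma third_sym s r p q : p != pt0 -> q != pt0 ->
  sim (third s r p q) (third s r q p).
Proof.
move=> p0 q0.
have E : proj_eq q p = proj_eq p q.
  apply/idP/idP => /proj_eq_sim h; apply: sim_proj_eq; apply: sim_sym; exact: h.
have [pq|pq] := boolP (proj_eq p q).
  have pq' := proj_eq_sim _ _ p0 q0 pq.
  exact: sim_third pq' (sim_sym _ _ pq').
exists (-1); first by rewrite oppr_eq0 oner_eq0.
rewrite /third E (negPf pq).
by case: p q {p0 q0 E pq} => [[x y] z] [[u v] w]; coords; apply: pt_ext; ring.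
Qed.

Lemma Opt_neq0 : Opt != pt0. Proof. by []. Qed.

Lemma Opt_on_curve s r : on_curve s r Opt.
Proof. by rewrite /on_curve Opt_neq0 /=; apply/eqP; rewrite /Opt; coords; ring. Qed.

(** [Opt] is a flex: its tangent meets the cubic nowhere else. The scalar is F at the second tangent
    point (- s, - s, - 2). *)
Lemma third_Opt_Opt s r : nonsingular s r -> sim (third s r Opt Opt) Opt.
Proof.
move=> /and3P[s0 r0 _]; apply: sim_sym; exists (8 * s * r ^+ 2).
  by rewrite !mulf_neq0 ?expf_neq0.
rewrite /third; have -> : proj_eq Opt Opt by apply: sim_proj_eq; exact: sim_refl.
have -> : cross (gradF s r Opt) Opt = (- s, - s, - 2).
  by rewrite /gradF /cross /Opt /mkpt; apply: pt_ext; rewrite /ptX /ptY /ptZ; cbn [fst snd]; ring.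
have -> : dot (gradF s r (- s, - s, - 2)) Opt = 0.
  by rewrite /gradF /dot /Opt /mkpt /ptX /ptY /ptZ; cbn [fst snd]; ring.
have -> : Fc s r (- s, - s, - 2) = 8 * s * r ^+ 2.
  by rewrite /Fc /ptX /ptY /ptZ; cbn [fst snd]; ring.
move: (8 * s * r ^+ 2) Opt (- s, - s, - 2) => k [[x y] z] [[u v] w].
by coords; apply: pt_ext; ring.
Qed.

Lemma refl_on_curve s r p : on_curve s r p -> on_curve s r (refl p).
Proof.
case: p => [[x y] z] /andP[p0 /eqP Fp]; apply/andP; split.
  by move: p0; rewrite /refl /mkpt /ptX /ptY /ptZ /= !pt_eq0 andbCA.
by apply/eqP; rewrite -Fp; coords; ring.
Qed.

Lemma on_curve_neq0 s r p : on_curve s r p -> p != pt0.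
Proof. by case/andP. Qed.

Lemma cadd_on_curve s r p q : nonsingular s r -> on_curve s r p -> on_curve s r q ->
  on_curve s r (cadd s r p q).
Proof. by move=> ns pC qC; apply: refl_on_curve; case: (third_cancel s r p q). Qed.

Lemma cmul_on_curve s r k p : nonsingular s r -> on_curve s r p ->
  on_curve s r (cmul s r k p).
Proof.
move=> ns pC; elim: k => [|k IH] /=; [exact: Opt_on_curve | exact: cadd_on_curve].
Qed.

Lemma sim_refl_Opt : sim (refl Opt) Opt.
Proof. by exists (-1); rewrite ?oppr_eq0 ?oner_eq0 //; apply/eqP. Qed.

(* p + q = - t means that p, q, t are collinear, hence p + t = - q; this replaces
   associativity. *)
Lemma cmul_torsion_refl s r p k j : nonsingular s r -> on_curve s r p ->
  sim (cmul s r k p) Opt -> (j <= k)%N ->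
  sim (cmul s r (k - j) p) (refl (cmul s r j p)).
Proof.
move=> ns pC kO; elim: j => [|j IH] jk.
  by rewrite subn0; apply: sim_trans kO _; apply: sim_sym sim_refl_Opt.
have {IH} := IH (ltnW jk).
have -> : (k - j = (k - j.+1).+1)%N by lia.
rewrite /=; set q := cmul s r (k - j.+1) p.
move=> /refl_sim; rewrite /cadd !reflK => h.
have qC : on_curve s r q by exact: cmul_on_curve.
have [_ hq] := third_cancel s r p q ns pC qC.
apply: sim_trans (sim_sym _ _ hq) _.
exact: sim_third (sim_refl p) h.
Qed.

(** If k is even and k P = O, half of k gives a point equal to its reflection. Such a point has X =
    Y, or has Z = 0 and X = - Y and is [Opt], contrary to the induction hypothesis. *)
Lemma cmul_neq_Opt s r p : nonsingular s r -> on_curve s r p ->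
  (forall q, on_curve s r q -> ptX q != ptY q) ->
  (forall k, odd k -> ~ sim (cmul s r k p) Opt) ->
  forall k, (0 < k)%N -> ~ sim (cmul s r k p) Opt.
Proof.
move=> ns pC no2 oddO; elim/ltn_ind => k IH k0.
have [/oddO //|ek] := boolP (odd k) => kO.
pose j := k./2; have kj : (k - j = j)%N by rewrite /j; lia.
have jlt : (j < k)%N by rewrite /j; lia.
have := cmul_torsion_refl s r p k j ns pC kO (ltnW jlt); rewrite kj.
have jC : on_curve s r (cmul s r j p) by exact: cmul_on_curve.
move=> /sim_proj_eq.
apply/negP/negP => h; apply: (IH j jlt); first by rewrite /j; lia.
have := no2 _ jC; move: h jC; move: (cmul s r j p) => [[x y] z].
rewrite /proj_eq /cross /refl /mkpt /ptX /ptY /ptZ /= pt_eq0.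
move=> /and3P[/eqP e1 /eqP e2 /eqP e3] /on_curve_neq0; rewrite pt_eq0 => p0 xy.
have xy0 : x - y != 0 by rewrite subr_eq0.
have z0 : z = 0 by apply: (mulfI xy0); lra.
have ey : y = - x by apply: (mulfI xy0); lra.
have x0 : x != 0 by move: p0; rewrite z0 ey oppr_eq0 eqxx andbT andbb.
apply: sim_sym; exists x => //; rewrite /Opt z0 ey.
by coords; apply: pt_ext; ring.
Qed.

(** Sums formed by [ccomb] end in [Opt]. If [q] and [Opt] had third point [Opt], cancellation and
    the flex would make [q] equal to [Opt]. *)
Lemma cadd_Opt_neq s r q : nonsingular s r -> on_curve s r q ->
  ~ sim q Opt -> ~ sim (cadd s r q Opt) Opt.
Proof.
move=> ns qC qO /refl_sim; rewrite /cadd reflK => h; apply: qO.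
have oC := Opt_on_curve s r.
have [_ hq] := third_cancel s r Opt q ns oC qC.
apply: sim_trans (sim_sym _ _ hq) _.
apply: sim_trans _ (third_Opt_Opt s r ns).
apply: sim_third (sim_refl _) _.
apply: sim_trans (third_sym s r _ _ Opt_neq0 (on_curve_neq0 _ _ _ qC)) _.
exact: sim_trans h sim_refl_Opt.
Qed.

(** [czmul] treats a negative integer by multiplying the reflected point, hence the separate
    hypotheses on [p] and [refl p]. *)
Lemma rank_ge1 s r p : nonsingular s r -> on_curve s r p ->
  (forall q, on_curve s r q -> ptX q != ptY q) ->
  (forall k, odd k -> ~ sim (cmul s r k p) Opt) ->
  (forall k, odd k -> ~ sim (cmul s r k (refl p)) Opt) ->
  rank_ge s r 1.
Proof.
move=> ns pC no2 oddp oddrp; exists [:: p]; split=> //; split; first by rewrite /= pC.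
case=> [|c [|c' cs]] // _; rewrite [has _ _]orbF => c0.
rewrite -[ccomb _ _ _ _]/(cadd s r (czmul s r c p) Opt).
have rC := refl_on_curve s r p pC.
have [mC mO] : on_curve s r (czmul s r c p) /\ ~ sim (czmul s r c p) Opt.
  case: c c0 => k kn0; rewrite /czmul.
    by split; [exact: cmul_on_curve | apply: cmul_neq_Opt => //; lia].
  by split; [exact: cmul_on_curve | exact: cmul_neq_Opt].
apply/negP => /(proj_eq_sim _ _ _ Opt_neq0) h.
apply: (cadd_Opt_neq s r _ ns mC mO); apply: h.
exact: on_curve_neq0 (cadd_on_curve s r _ _ ns mC (Opt_on_curve s r)).
Qed.

(** * Parity tracking at 2 *)

(* q lies in the localization of Z at 2 and is congruent to b modulo 2. *)
Definition par2 (b : bool) (q : rat) : Prop :=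
  exists a d : int, [/\ odd `|d|, odd `|a| = b & q = a%:~R / d%:~R].

Lemma oddz_neq0 (d : int) : odd `|d| -> (d%:~R : rat) != 0.
Proof. by rewrite intr_eq0; case: eqP => // ->. Qed.

Lemma par2_eq b b' x : par2 b x -> b = b' -> par2 b' x.
Proof. by move=> h <-. Qed.

Lemma par2_nat n : par2 (odd n) n%:R.
Proof. by exists n%:Z, 1; split; rewrite ?divr1. Qed.

Lemma par2D b c x y : par2 b x -> par2 c y -> par2 (b (+) c) (x + y).
Proof.
move=> [a [d [d1 <- ->]]] [a' [d' [d1' <- ->]]].
exists (a * d' + a' * d), (d * d'); split.
- by rewrite abszM oddM d1 d1'.
- by lia.
rewrite intrD !intrM; field; by rewrite !oddz_neq0.
Qed.

Lemma par2M b c x y : par2 b x -> par2 c y -> par2 (b && c) (x * y).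
Proof.
move=> [a [d [d1 <- ->]]] [a' [d' [d1' <- ->]]].
exists (a * a'), (d * d'); split; rewrite ?abszM ?oddM ?d1 ?d1' //.
rewrite !intrM; field; by rewrite !oddz_neq0.
Qed.

Lemma par2N b x : par2 b x -> par2 b (- x).
Proof.
by move=> [a [d [d1 <- ->]]]; exists (- a), d; split; rewrite ?abszN ?intrN ?mulNr.
Qed.

Lemma par2V x : par2 true x -> par2 true x^-1.
Proof. by move=> [a [d [d1 a1 ->]]]; exists d, a; rewrite invf_div. Qed.

Lemma par2_neq0 x : par2 true x -> x != 0.
Proof. by move=> [a [d [d1 a1 ->]]]; rewrite mulf_neq0 ?invr_eq0 ?oddz_neq0. Qed.

Lemma par2X b n x : par2 b x -> par2 b (x ^+ n.+1).
Proof.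
move=> h; elim: n => [|n IH] //.
by rewrite exprS; apply: par2_eq (par2M _ _ _ _ h IH) (andbb b).
Qed.

(** The parity is first computed from the shape of the term as a boolean expression, then compared
    with the wanted one by cases on the unknown parities. *)
Ltac par2_tree :=
  lazymatch goal with
  | |- par2 _ (_ + _) => eapply par2D; [par2_tree | par2_tree]
  | |- par2 _ (- _) => eapply par2N; par2_tree
  | |- par2 _ (_ * _) => eapply par2M; [par2_tree | par2_tree]
  | |- par2 _ (_ ^-1) => eapply par2V; par2
  | |- par2 _ (_ ^+ _) => eapply par2X; par2_tree
  | |- par2 _ (_ %:R) => exact: (par2_nat _)
  | |- par2 _ 1 => exact: (par2_nat 1)
  | _ => eassumption
  end
with par2 := eapply par2_eq;
  [ par2_tree
  | rewrite /=; repeat match goal with |- context [?b] => is_var b; destruct b end;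
    reflexivity ].

Lemma nonsingular_factors dl s r : nonsingular (dl * s) (dl * r) ->
  [/\ dl != 0, s != 0 & r != 0].
Proof.
move=> /and3P[S0 R0 _]; split.
- by apply: contraNneq S0 => ->; rewrite mul0r.
- by apply: contraNneq S0 => ->; rewrite mulr0.
- by apply: contraNneq R0 => ->; rewrite mulr0.
Qed.

(** * Additive reduction at 2 *)

Section Additive.

Variables dl s r : rat.
Hypotheses (ns : nonsingular (dl * s) (dl * r)) (s_even : par2 false s)
  (r_odd : par2 true r).
Let c := s * r ^+ 2.

(* Here z = Z / X and w = W / (c X) are rescaled affine coordinates: modulo 2
   the curve becomes the cusp w = - z^3, on which z is an additive parameter. *)
Definition stA (b : bool) (p : pt) : Prop :=
  exists k z w, [/\ k != 0, par2 b z, exists b', par2 b' w,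
    w * (s * z - 1 - c * w) = z ^+ 3
    & p = ptscale k (dl, dl * (s * z - 1 - c * w), z)].

(** On the cusp the z-coordinates of three collinear points sum to zero. The slope has an odd
    denominator, so one computation covers chords, tangents and points that merge modulo 2. *)
Lemma stA_add b1 b2 p q : on_curve (dl * s) (dl * r) p -> on_curve (dl * s) (dl * r) q ->
  stA b1 p -> stA b2 q -> stA (b1 (+) b2) (cadd (dl * s) (dl * r) p q).
Proof.
move=> pC qC [k1 [z1 [w1 [k10 z1P [bw1 w1P] e1 pE]]]] [k2 [z2 [w2 [k20 z2P [bw2 w2P] e2 qE]]]].
have [TC _] := third_cancel _ _ p q ns pC qC.
have /and3P[S0 R0 sr] := ns.
have [dl0 s0 r0] := nonsingular_factors _ _ _ ns.
have c_even : par2 false c by rewrite /c; par2.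
have c0 : c != 0 by rewrite /c mulf_neq0 ?expf_neq0.
set p1 : pt := (dl, dl * (s * z1 - 1 - c * w1), z1).
have simp : sim p p1 by apply: sim_sym; exists k1.
have p1C := sim_on_curve _ _ _ _ simp pC.
(* Subtracting the two curve equations gives M (w2 - w1) = N (z2 - z1), so [N / M] is the slope of
   the chord, and of the tangent when the points coincide. *)
pose M := 1 - s * z1 + c * (w1 + w2).
pose N := - (z1 ^+ 2 + z1 * z2 + z2 ^+ 2) + s * w2.
have M_odd : par2 true M by rewrite /M; par2.
have M0 := par2_neq0 _ M_odd.
have [bl lP] : exists b, par2 b (N / M) by eexists; rewrite /N /M; par2.
set l := N / M in lP.
have hM : l * M = N by rewrite /l divfK.
pose t := z2 - z1.
have hL : l * t = w2 - w1.
  by apply: (mulIf M0); rewrite mulrAC hM /N /M /t; lra.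
pose h := s - c * l.
(* With [d] the direction of slope [l], the cubic on p1 + y d vanishes at y = 0, t and - a. *)
pose a := t - h * l + 3 * z1.
pose d : pt := (0, dl * h, 1).
have aE : a * t = (s * z1 - 1 - c * w1) * l + h * w1 - 3 * z1 ^+ 2.
  have : h * (l * t) = h * (w2 - w1) by rewrite hL.
  by move: hM; rewrite /a /h /M /N /t; lra.
have simq : sim q (lin 1 p1 t d).
  apply: sim_sym; exists k2 => //; rewrite qE; congr ptscale.
  rewrite /p1 /d; coords; apply: pt_ext; rewrite /h /t; first by ring.
    have : c * (l * t) = c * (w2 - w1) by rewrite hL.
    by rewrite /t => e; have := congr1 ( *%R dl) e; lra.
  by ring.
have cpd : cross p1 d != pt0.
  by rewrite /p1 /d; coords; rewrite pt_eq0 !mulr0 !mulr1 sub0r oppr_eq0 (negPf dl0) andbF.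
have Fp1 : Fc (dl * s) (dl * r) p1 = 0 by case/andP: p1C => _ /eqP.
have g0 := gradF_neq0 _ _ _ S0 R0 sr p1C.
have T := third_residual (dl * s) (dl * r) p1 d 1 t (dl ^+ 3 * c * a) (dl ^+ 3 * c) Fp1 g0 cpd.
have {}T : sim (third (dl * s) (dl * r) p q)
     (lin (dl ^+ 3 * c) p1 (- (dl ^+ 3 * c * a)) d).
  apply: sim_trans (sim_third _ _ _ _ _ _ simp simq) (T _ _ _ _).
  - by rewrite oner_eq0.
  - by rewrite -mulrA aE /p1 /d; coords; rewrite /h /c; ring.
  - by rewrite /d; coords; rewrite /h /c; ring.
  - by rewrite /p1 /d; coords; rewrite /a /h /c; ring.
pose z3 := z1 - a; pose w3 := w1 - a * l; pose y3 := s * z3 - 1 - c * w3.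
have RE : lin (dl ^+ 3 * c) p1 (- (dl ^+ 3 * c * a)) d = ptscale (dl ^+ 3 * c) (dl, dl * y3, z3).
  by rewrite /p1 /d; coords; apply: pt_ext; rewrite /y3 /z3 /w3 /h; ring.
rewrite RE in T.
have e3 : w3 * y3 = z3 ^+ 3.
  have /andP[_ /eqP] := sim_on_curve _ _ _ _ T TC.
  have be0 : dl ^+ 3 * c != 0 by rewrite mulf_neq0 ?expf_neq0.
  rewrite Fc_scale -[RHS](mulr0 ((dl ^+ 3 * c) ^+ 3)).
  move=> /(mulfI (expf_neq0 3 be0)) F3; apply: (mulfI be0).
  by move: F3; coords; rewrite /y3 /c; lra.
have z3P : par2 (b1 (+) b2) z3 by rewrite /z3 /a /t /h; par2.
have [bw3 w3P] : exists b, par2 b w3 by eexists; rewrite /w3 /a /t /h; par2.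
have y3P : par2 true y3 by rewrite /y3; par2.
have y30 := par2_neq0 _ y3P.
(* Reflection divides z and w by [y3], which is odd, so their parities survive. *)
have invE : s * (z3 / y3) - 1 - c * (w3 / y3) = y3^-1.
  apply: (mulfI y30); rewrite mulfV //.
  transitivity (s * z3 - y3 - c * w3); first by field.
  by rewrite /y3; ring.
have /refl_sim [k k0 E] := sim_sym _ _ T.
exists (k * (dl ^+ 3 * c) * y3), (z3 / y3), (w3 / y3); split.
- by rewrite !mulf_neq0 ?expf_neq0.
- by par2.
- by eexists; par2.
- by rewrite invE expr_div_n -e3; field.
rewrite /cadd E invE; move: y3 y30 {e3 y3P RE T E invE} => y3 y30.
by coords; apply: pt_ext; field.
Qed.

End Additive.

(** On k P the parity of z is that of k; an odd z is nonzero, whereas Z = 0 at [Opt]. *)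
Lemma stA_odd_cmul dl s r p k : nonsingular (dl * s) (dl * r) ->
  par2 false s -> par2 true r -> on_curve (dl * s) (dl * r) p ->
  stA dl s r true p -> odd k -> ~ sim (cmul (dl * s) (dl * r) k p) Opt.
Proof.
move=> ns sP rP pC pA kodd.
have [dl0 _ _] := nonsingular_factors _ _ _ ns.
have : stA dl s r (odd k) (cmul (dl * s) (dl * r) k p).
  elim: k {kodd} => [|k IH].
    exists dl^-1, 0, 0; split; rewrite ?invr_eq0 //.
    - exact: (par2_nat 0).
    - by exists false; exact: (par2_nat 0).
    - by rewrite mul0r expr0n.
    by rewrite /Opt; coords; apply: pt_ext; field.
  by apply: (stA_add _ _ _ ns sP rP true) => //; exact: cmul_on_curve.
rewrite kodd => -[k1 [z [w [k0 zP _ _ ->]]]] [l l0].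
move=> /(congr1 ptZ); coords => /eqP; rewrite eq_sym !mulf_eq0.
by rewrite (negPf l0) (negPf k0) (negPf (par2_neq0 _ zP)).
Qed.

Lemma stA_point dl s r x y : par2 true x -> par2 true y ->
  x * y * (s - x - y) = s * r ^+ 2 -> stA dl s r true (dl * x, dl * y, 1).
Proof.
move=> xP yP e; have [x0 y0] := (par2_neq0 _ xP, par2_neq0 _ yP).
have E : s * x^-1 - 1 - s * r ^+ 2 * (x ^+ 2 * y)^-1 = y / x.
  by rewrite -e; field; rewrite x0.
(* The last witness is W / (c X), rewritten by the curve equation. *)
exists x, x^-1, (x ^+ 2 * y)^-1; split => //.
- by par2.
- by exists true; par2.
- by rewrite E; field; rewrite x0.
by rewrite E; coords; apply: pt_ext; field.
Qed.

(** * Multiplicative reduction at 2 *)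

Section Multiplicative.

Variables dl s h r : rat.
Hypotheses (ns : nonsingular (dl * s) (dl * (h * r))) (s_odd : par2 true s)
  (h_even : par2 false h) (r_odd : par2 true r).

(* For b = false, the kernel of reduction modulo 2; for b = true, the points
   whose coordinates satisfy v(X) = v(Y) = v(Z dl h) for the 2-adic valuation v. *)
Definition stB (b : bool) (p : pt) : Prop :=
  if b then exists k x y, [/\ k != 0, par2 true x, par2 true y,
    x * y * (s - h * (x + y)) = s * r ^+ 2 & p = ptscale k (dl * (h * x), dl * (h * y), 1)]
  else exists k y z, [/\ k != 0, par2 true y, par2 false z,
    y * (s * z - 1 - y) = s * (h * r) ^+ 2 * z ^+ 3 & p = ptscale k (dl, dl * y, z)].

(** After division by [dl * h] both points have odd affine coordinates, and the line has odd slope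
    [l]. The factor [l * (1 + l)] of Z is then even, which puts the sum in the kernel of
    reduction. *)
Lemma stB_add_odd_odd p q :
  on_curve (dl * s) (dl * (h * r)) p -> on_curve (dl * s) (dl * (h * r)) q ->
  stB true p -> stB true q -> stB false (cadd (dl * s) (dl * (h * r)) p q).
Proof.
move=> pC qC [k1 [x1 [y1 [k10 x1P y1P e1 pE]]]] [k2 [x2 [y2 [k20 x2P y2P e2 qE]]]].
have [TC _] := third_cancel _ _ p q ns pC qC.
have [dl0 s0 hr0] := nonsingular_factors _ _ _ ns.
have /and3P[S0 R0 sr] := ns.
have h0 : h != 0 by apply: contraNneq hr0 => ->; rewrite mul0r.
set p1 : pt := (dl * (h * x1), dl * (h * y1), 1).
have simp : sim p p1 by apply: sim_sym; exists k1.
have p1C := sim_on_curve _ _ _ _ simp pC.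
(* The difference of the curve equations is U (x2 - x1) + V (y2 - y1) = 0; for coinciding points
   [- U / V] is the tangent slope. *)
pose U := y1 * (s - h * (x1 + x2 + y1)).
pose V := x2 * (s - h * (x2 + y1 + y2)).
have VP : par2 true V by rewrite /V; par2.
have V0 := par2_neq0 _ VP.
have lP : par2 true (- U / V) by rewrite /U; par2.
set l := - U / V in lP.
have hl : l * V = - U by rewrite /l divfK.
pose t := x2 - x1.
have hL : l * t = y2 - y1.
  by apply: (mulIf V0); rewrite mulrAC hl /U /V /t; lra.
pose d : pt := (dl * h, dl * (h * l), 0).
(* [k * be] is - F(d) and [k * D] is the polar at [d] of [p1]. *)
pose be := h * l * (1 + l).
pose D := s * l - h * (l * (x1 + y1) + (x1 * l + y1) * (1 + l)).
have DP : par2 true D by rewrite /D; par2.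
pose k := dl ^+ 3 * h ^+ 2.
have k0 : k != 0 by rewrite mulf_neq0 ?expf_neq0.
have simq : sim q (lin 1 p1 t d).
  apply: sim_sym; exists k2 => //; rewrite qE; congr ptscale.
  rewrite /p1 /d; coords; apply: pt_ext; [by rewrite /t; ring | | by ring].
  have -> : y2 = y1 + l * t by rewrite hL; ring.
  by ring.
have cpd : cross p1 d != pt0.
  rewrite /p1 /d; coords; rewrite pt_eq0 !mulr0 !mul1r sub0r subr0.
  by rewrite [in X in _ && X]mulf_eq0 (negPf dl0) (negPf h0) andbF.
have Fp1 : Fc (dl * s) (dl * (h * r)) p1 = 0 by case/andP: p1C => _ /eqP.
have g0 := gradF_neq0 _ _ _ S0 R0 sr p1C.
have aE : (t * be - D) * t =
    s * (x1 * l + y1) - h * (x1 * y1 * (1 + l) + (x1 * l + y1) * (x1 + y1)).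
  have e : y2 = y1 + l * t by rewrite hL; ring.
  have ex : x2 = x1 + t by rewrite /t; ring.
  by move: hl; rewrite /U /V e ex /be /D; lra.
have T := third_residual (dl * s) (dl * (h * r)) p1 d 1 t (k * (t * be - D)) (k * be) Fp1 g0 cpd.
have {}T : sim (third (dl * s) (dl * (h * r)) p q)
     (lin (k * be) p1 (- (k * (t * be - D))) d).
  apply: sim_trans (sim_third _ _ _ _ _ _ simp simq) (T _ _ _ _).
  - by rewrite oner_eq0.
  - by rewrite -mulrA aE /k /p1 /d; coords; ring.
  - by rewrite /k /be /d; coords; ring.
  - by rewrite /k /be /D /p1 /d; coords; ring.
(* Up to the factor k, the third point is be p1 - (t be - D) d, with first coordinates dl h X and dl
   h Y. *)
pose X := D + be * (x1 - t); pose Y := l * D + be * (y1 - l * t).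
have XP : par2 true X by rewrite /X /be /t; par2.
have YP : par2 true Y by rewrite /Y /be /t; par2.
have [X0 Y0] := (par2_neq0 _ XP, par2_neq0 _ YP).
have RE : lin (k * be) p1 (- (k * (t * be - D))) d =
    ptscale (k * h * Y) (dl * X / Y, dl, l * (1 + l) / Y).
  rewrite /p1 /d; coords.
  apply: pt_ext; first by rewrite /X; field.
    by rewrite /Y; ring.
  by rewrite /be; field.
rewrite RE in T.
have /refl_sim /sim_sym [k' k'0 E] := T.
have {TC} /andP[_ /eqP] := sim_on_curve _ _ _ _ T TC.
have K0 : k * h * Y != 0 by rewrite !mulf_neq0.
rewrite Fc_scale -[RHS](mulr0 ((k * h * Y) ^+ 3)).
move=> /(mulfI (expf_neq0 3 K0)) F3.
exists (k' * (k * h * Y)), (X / Y), (l * (1 + l) / Y); split.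
- by rewrite mulf_neq0.
- by par2.
- by par2.
- apply: (mulfI (expf_neq0 3 dl0)); apply: subr0_eq; rewrite -[RHS]F3; coords.
  by rewrite -[dl * X / Y]mulrA; move: (X / Y) (_ / Y) => u v; ring.
by rewrite /cadd E; coords; apply: pt_ext; field.
Qed.

(** The points differ, so the chord formula applies; its weights are an odd [B] and [h] times an
    even [A], so the odd coordinates of the first point prevail modulo 2. *)
Lemma stB_add_odd_even p q :
  on_curve (dl * s) (dl * (h * r)) p -> on_curve (dl * s) (dl * (h * r)) q ->
  stB true p -> stB false q -> stB true (cadd (dl * s) (dl * (h * r)) p q).
Proof.
move=> pC qC [k1 [x1 [y1 [k10 x1P y1P e1 pE]]]] [k2 [y2 [z2 [k20 y2P z2P e2 qE]]]].
have [TC _] := third_cancel _ _ p q ns pC qC.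
have [dl0 s0 hr0] := nonsingular_factors _ _ _ ns.
have h0 : h != 0 by apply: contraNneq hr0 => ->; rewrite mul0r.
(* Up to dl^3, [h * A] is the polar at the first normalised point of the second, and [B] the polar
   at the second of the first. *)
pose A := s * y1 - 2 * h * x1 * y1 - h * y1 ^+ 2
  + (s * x1 - h * x1 ^+ 2 - 2 * h * x1 * y1) * y2
  + h * (s * x1 * y1 - 3 * s * r ^+ 2) * z2.
pose B := h * x1 * (s * y2 * z2 - 2 * y2 - y2 ^+ 2) + h * y1 * (s * z2 - 1 - 2 * y2)
  + s * y2 - 3 * s * (h * r) ^+ 2 * z2 ^+ 2.
have AP : par2 false A by rewrite /A; par2.
have BP : par2 true B by rewrite /B; par2.
pose X := B * x1 - A; pose Y := B * y1 - A * y2; pose Z := B - h * A * z2.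
have XP : par2 true X by rewrite /X; par2.
have YP : par2 true Y by rewrite /Y; par2.
have ZP : par2 true Z by rewrite /Z; par2.
have Z0 := par2_neq0 _ ZP.
have T : sim (third (dl * s) (dl * (h * r)) p q)
    (ptscale Z (dl * (h * (X / Z)), dl * (h * (Y / Z)), 1)).
  rewrite pE qE; apply: sim_trans (sim_sym _ _ (third_scale_l _ _ _ _ _ k10)) _.
  apply: sim_trans (sim_sym _ _ (third_scale_r _ _ _ _ _ k20)) _.
  apply: sim_sym; exists (dl ^+ 3); first by rewrite expf_neq0.
  have -> : third (dl * s) (dl * (h * r)) (dl * (h * x1), dl * (h * y1), 1) (dl, dl * y2, z2)
    = lin (polar (dl * s) (dl * (h * r)) (dl, dl * y2, z2) (dl * (h * x1), dl * (h * y1), 1))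
        (dl * (h * x1), dl * (h * y1), 1)
        (- polar (dl * s) (dl * (h * r)) (dl * (h * x1), dl * (h * y1), 1) (dl, dl * y2, z2))
        (dl, dl * y2, z2).
    rewrite /third ifF; first by coords; apply: pt_ext; ring.
    rewrite /proj_eq; coords; rewrite pt_eq0; apply/negP => /and3P[_ /eqP e _].
    (* Equal points would give h x1 z2 = 1, with an even left side. *)
    have /par2_neq0/eqP : par2 true (1 - h * x1 * z2) by par2.
    by apply; apply: (mulfI dl0); lra.
  have -> : polar (dl * s) (dl * (h * r)) (dl, dl * y2, z2) (dl * (h * x1), dl * (h * y1), 1) = dl ^+ 3 * B.
    by rewrite /B; coords; ring.
  have -> : polar (dl * s) (dl * (h * r)) (dl * (h * x1), dl * (h * y1), 1) (dl, dl * y2, z2) = dl ^+ 3 * (h * A).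
    by rewrite /A; coords; ring.
  coords; apply: pt_ext.
  - by transitivity (dl ^+ 3 * dl * h * X); [rewrite /X; ring | field].
  - by transitivity (dl ^+ 3 * dl * h * Y); [rewrite /Y; ring | field].
  - by rewrite /Z; ring.
have {TC} /andP[_ /eqP] := sim_on_curve _ _ _ _ T TC.
rewrite Fc_scale -[RHS](mulr0 (Z ^+ 3)).
move=> /(mulfI (expf_neq0 3 Z0)) F3.
have /refl_sim /sim_sym [k' k'0 E] := T.
exists (k' * Z), (Y / Z), (X / Z); split.
- by rewrite mulf_neq0.
- by par2.
- by par2.
- have K0 : dl ^+ 3 * h ^+ 2 != 0 by rewrite mulf_neq0 ?expf_neq0.
  apply: (mulfI K0); apply: subr0_eq; rewrite -[RHS]F3; coords.
  by move: (X / Z) (Y / Z) => u v; ring.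
by rewrite /cadd E; coords; apply: pt_ext; ring.
Qed.

(** Each step of [cmul] adds [p], of class [true], so the two addition lemmas alternate. Class
    [true] has Z nonzero, unlike [Opt]. *)
Lemma stB_odd_cmul p k : on_curve (dl * s) (dl * (h * r)) p ->
  stB true p -> odd k -> ~ sim (cmul (dl * s) (dl * (h * r)) k p) Opt.
Proof.
move=> pC pB kodd.
have [dl0 _ _] := nonsingular_factors _ _ _ ns.
have : stB (odd k) (cmul (dl * s) (dl * (h * r)) k p).
  elim: k {kodd} => [|k].
    exists dl^-1, (-1), 0; split; rewrite ?invr_eq0 //.
    - exact: par2N _ _ (par2_nat 1).
    - exact: (par2_nat 0).
    - by ring.
    by rewrite /Opt; coords; apply: pt_ext; field.
  have kC := cmul_on_curve _ _ k p ns pC.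
  rewrite [odd _.+1]/=; case: (odd k) => IH; first exact: stB_add_odd_odd.
  exact: stB_add_odd_even.
rewrite kodd => -[k1 [x [y [k0 _ _ _ ->]]]] [l l0].
move=> /(congr1 ptZ); coords => /eqP; rewrite eq_sym !mulf_eq0.
by rewrite (negPf l0) (negPf k0) oner_eq0.
Qed.

Lemma stB_point x y : par2 true x -> par2 true y ->
  x * y * (s - h * (x + y)) = s * r ^+ 2 -> stB true (dl * (h * x), dl * (h * y), 1).
Proof.
by move=> xP yP e; exists 1, x, y; split; rewrite ?oner_eq0 ?ptscale1.
Qed.

End Multiplicative.

(** * Rational 2-torsion and cubes *)

(** With k = gcd(m, A), k^3 divides m K and is prime to K; conversely m / k is prime to A / k, hence
    divides k^2. *)
Lemma coprime_mul_cube (m K A : nat) : (0 < m)%N -> coprime m K ->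
  (m * K = A ^ 3)%N -> m = (gcdn m A ^ 3)%N.
Proof.
move=> m0 mK e; set k := gcdn m A.
have k0 : (0 < k)%N by rewrite gcdn_gt0 m0.
have [/dvdnP[m1 em] /dvdnP[A1 eA]] := (dvdn_gcdl m A, dvdn_gcdr m A).
rewrite -/k in em eA.
apply/eqP; rewrite eqn_dvd; apply/andP; split; last first.
  have ck : coprime (k ^ 3) K.
    by apply: coprimeXl; apply: coprime_dvdl mK; exact: dvdn_gcdl.
  by rewrite -(Gauss_dvdl _ ck) e dvdn_exp2r // dvdn_gcdr.
have c1 : coprime m1 (A1 ^ 3).
  apply: coprimeXr; rewrite /coprime -(eqn_pmul2r k0) mul1n muln_gcdl -em -eA.
  by rewrite eqxx.
rewrite {1}em (expnS k 2) mulnC dvdn_pmul2l // -(Gauss_dvdr _ c1).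
apply/dvdnP; exists K; apply/eqP; rewrite -(eqn_pmul2r k0); apply/eqP.
move: e; rewrite {1}em eA expnMn => e.
by rewrite -mulnA -expnSr -e mulnC mulnA.
Qed.

(** A / B is to be the coordinate x = y of a point of order 2, and D = |A^2 - (r B)^2| with r = n (m
    - n). A prime dividing m and A divides none of m + n, B, D, so m is a cube up to the factor
    2. *)
Lemma two_torsion_cube (m n A B D : nat) :
  (0 < n < m)%N -> coprime m n -> coprime A B ->
  (forall p, prime p -> p %| D -> p %| A -> p %| n * (m - n) * B)%N ->
  (m * ((m + n) * B * D) = 2 * A ^ 3)%N ->
  (odd m /\ exists k, m = k ^ 3)%N \/ (exists k, m = 2 * k ^ 3)%N.
Proof.
move=> /andP[n0 nm] mn AB hD; set K := ((m + n) * B * D)%N => e.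
have key p : prime p -> (p %| m -> p %| A -> p %| K -> False)%N.
  move=> pp pm pA.
  have pn : ~~ (p %| n)%N.
    apply/negP => pn; have : (p %| gcdn m n)%N by rewrite dvdn_gcd pm pn.
    by rewrite (eqP mn) dvdn1; case: eqP pp => // ->.
  have pB : ~~ (p %| B)%N.
    apply/negP => pB; have : (p %| gcdn A B)%N by rewrite dvdn_gcd pA pB.
    by rewrite (eqP AB) dvdn1; case: eqP pp => // ->.
  rewrite /K !Euclid_dvdM // dvdn_addr // (negPf pn) (negPf pB) /= => pD.
  have := hD p pp pD pA; rewrite !Euclid_dvdM // (negPf pn) (negPf pB) orbF /=.
  by rewrite dvdn_subr ?(ltnW nm) // (negPf pn).
have m0 : (0 < m)%N by exact: leq_trans nm.
have prime_coprime_ext (u v : nat) : (0 < u)%N ->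
    (forall p, prime p -> p %| u -> p %| v -> False)%N -> coprime u v.
  move=> u0 h; rewrite /coprime; apply/negPn/negP => g1.
  have g2 : (1 < gcdn u v)%N by rewrite ltn_neqAle eq_sym g1 gcdn_gt0 u0.
  apply: (h _ (pdiv_prime g2)); apply: dvdn_trans (pdiv_dvd _) _.
    exact: dvdn_gcdl.
  exact: dvdn_gcdr.
have [om|em] := boolP (odd m).
  (* For m odd the 2 comes out of [K]: m (K / 2) = A^3. *)
  left; split => //; have K2 : (K = 2 * K./2)%N.
    by have := congr1 odd e; rewrite !oddM om /=; lia.
  exists (gcdn m A); apply: (@coprime_mul_cube m K./2) => //.
    apply: prime_coprime_ext => // p pp pm pK.
    have p2 : coprime p 2.
      by rewrite coprimen2; apply: dvdn_odd pm om.
    apply: (key p pp pm); last by rewrite K2 dvdn_mull.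
    have : (p %| 2 * A ^ 3)%N by rewrite -e dvdn_mulr.
    by rewrite Gauss_dvdr // Euclid_dvdX // => /andP[].
  by move: e; rewrite K2; nia.
(* For m even the 2 comes out of m: (m / 2) K = A^3. *)
right; have m2 : (m = 2 * m./2)%N by lia.
exists (gcdn m./2 A).
rewrite {1}m2; congr (2 * _)%N; apply: (@coprime_mul_cube m./2 K); first by lia.
  apply: prime_coprime_ext; first by lia.
  move=> p pp pm pK; apply: (key p pp) pK.
    by rewrite m2 dvdn_mull.
  have eA : (A ^ 3 = m./2 * K)%N by nia.
  have : (p %| A ^ 3)%N by rewrite eA dvdn_mulr.
  by rewrite Euclid_dvdX // => /andP[].
by nia.
Qed.

(** On x = y a point has Z nonzero, and t = x / z satisfies s (t^2 - r^2) = 2 t^3; writing t in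
    lowest terms leads to [two_torsion_cube]. *)
Lemma no_two_torsion (m n : nat) :
  (0 < n)%N -> (n < m)%N -> coprime m n ->
  ~ (odd m /\ exists k : nat, m = (k ^ 3)%N) ->
  ~ (exists k : nat, m = (2 * k ^ 3)%N) ->
  forall q, on_curve (m * (m + n))%N%:R (n * (m - n))%N%:R q -> ptX q != ptY q.
Proof.
move=> n0 nm mn h1 h2 [[x y] z] /andP[q0 /eqP]; rewrite /Fc /ptX /ptY /ptZ /= => F0.
apply/eqP => xy; subst y.
set s := (m * (m + n))%N in F0; set r := (n * (m - n))%N in F0.
have s0 : (0 < s)%N by rewrite muln_gt0; lia.
have r0 : (0 < r)%N by rewrite muln_gt0; lia.
have z0 : z != 0.
  apply: contraNneq q0 => z0; rewrite z0 in F0 *.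
  have : x ^+ 3 == 0 by apply/eqP; lra.
  by rewrite pt_eq0 expf_eq0 /= => ->; rewrite eqxx.
pose t := x / z.
have xE : x = t * z by rewrite /t divfK.
have et : s%:R * (t ^+ 2 - r%:R ^+ 2) = 2 * t ^+ 3.
  by apply: (mulIf (expf_neq0 3 z0)); rewrite xE in F0; lra.
have d0 : (denq t)%:~R != 0 :> rat by rewrite intr_eq0 denq_neq0.
have ez : s%:Z * denq t * (numq t ^+ 2 - (r%:Z * denq t) ^+ 2) = 2 * numq t ^+ 3.
  apply/eqP; rewrite -(eqr_int rat) !exprS !expr0 !mulr1 !(intrM, intrB) -!pmulrn; apply/eqP.
  have nE : (numq t)%:~R = t * (denq t)%:~R by rewrite -{2}[t]divq_num_den divfK.
  rewrite nE; move: (denq t)%:~R d0 => d _.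
  by transitivity (d ^+ 3 * (s%:R * (t ^+ 2 - r%:R ^+ 2))); [ring | rewrite et; ring].
have := @two_torsion_cube m n `|numq t| `|denq t| `|numq t ^+ 2 - (r%:Z * denq t) ^+ 2|.
case=> //; first by rewrite n0 nm.
- exact: coprime_num_den.
- move=> p pp pD pA.
  have : (p%:Z %| (r%:Z * denq t) ^+ 2)%Z.
    have -> : (r%:Z * denq t) ^+ 2 =
      numq t ^+ 2 - (numq t ^+ 2 - (r%:Z * denq t) ^+ 2) by ring.
    by rewrite rpredB // expr2 dvdz_mulr.
  by rewrite dvdzE expr2 !abszM Euclid_dvdM // orbb.
have := congr1 absz ez; rewrite !abszM.
move: `|_ - _|%N `|denq t|%N `|numq t|%N => D B A /=; rewrite /s => e.
by rewrite !mulnA in e *; rewrite e; lia.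
Qed.

(** * The point from the triangle and the two reduction types *)

Lemma nonsingular_nat (s r : nat) : (0 < s)%N -> (0 < r)%N -> nonsingular s%:R r%:R.
Proof.
move=> s0 r0; have r0' : r%:R != 0 :> rat by rewrite pnatr_eq0 -lt0n.
apply/and3P; split; rewrite ?pnatr_eq0 -?lt0n //.
apply: contra (three_not_square (s%:R / (3 * r%:R))) => /eqP e.
by rewrite expr_div_n e; apply/eqP; field.
Qed.

Lemma rank_ge1_opposite_parity (dl : rat) (a b : nat) (s r : rat) : odd a != odd b ->
  s = dl * (a * (a + b))%N%:R -> r = dl * (b%:R * (a%:R - b%:R)) ->
  nonsingular s r ->
  (forall q, on_curve s r q -> ptX q != ptY q) ->
  rank_ge s r 1.
Proof.
rewrite natrM natrD; set al := a%:R; set be := b%:R => ab -> -> ns no2.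
have alP : par2 (odd a) al by exact: par2_nat.
have beP : par2 (odd b) be by exact: par2_nat.
(* For dl = 1 the affine coordinates are s minus the sides a^2 - b^2 and a^2 + b^2. *)
pose p : pt := (dl * (be * (al + be)), dl * (be * (al - be)), 1).
have rE : refl p = (dl * (be * (al - be)), dl * (be * (al + be)), 1) by [].
have pC : on_curve (dl * (al * (al + be))) (dl * (be * (al - be))) p.
  rewrite /on_curve pt_eq0 oner_eq0 !andbF /=; apply/eqP.
  by rewrite /p; coords; ring.
have rC := refl_on_curve _ _ _ pC.
case: (odd a) alP ab => alP; case: (odd b) beP => beP // _.
  (* a odd, b even: the multiplicative case with h = b and odd coordinates a + b, a - b. *)
  apply: (rank_ge1 _ _ p) => // k kodd.
    by apply: (stB_odd_cmul dl _ be) => //; [par2 | par2 | apply: stB_point; [par2 | par2 | ring]].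
  apply: (stB_odd_cmul dl _ be) => //; [par2 | par2 | rewrite rE; apply: stB_point; [par2 | par2 | ring]].
(* a even, b odd: the additive case, with a (a + b) even and b (a - b) and both coordinates odd. *)
apply: (rank_ge1 _ _ p) => // k kodd.
  apply: stA_odd_cmul => //; [par2 | par2 | apply: stA_point; [par2 | par2 | ring]].
apply: stA_odd_cmul => //; [par2 | par2 | rewrite rE; apply: stA_point; [par2 | par2 | ring]].
Qed.

Theorem theorem4 (m n : nat) :
  (0 < n)%N -> (n < m)%N -> coprime m n ->
  ~ (odd m /\ exists k : nat, m = (k ^ 3)%N) ->
  ~ (exists k : nat, m = (2 * k ^ 3)%N) ->
  rank_ge ((m * (m + n))%N%:R) ((n * (m - n))%N%:R) 1.
Proof.
move=> n0 nm mn h1 h2.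
have ns : nonsingular (m * (m + n))%N%:R (n * (m - n))%N%:R.
  by apply: nonsingular_nat; rewrite muln_gt0; lia.
have no2 := no_two_torsion m n n0 nm mn h1 h2.
have [par|par] := eqVneq (odd m) (odd n); last first.
  apply: (rank_ge1_opposite_parity 1 m n) => //; first by rewrite mul1r.
  by rewrite natrM natrB ?(ltnW nm) // mul1r.
have mo : odd m.
  apply/negPn/negP => em; have : (2 %| gcdn m n)%N.
    by rewrite dvdn_gcd !dvdn2 -par em.
  by rewrite (eqP mn).
(* Both are odd, so the half sum a and half difference b are integers; a + b = m is odd, so their
   parities differ. Then 2 a (a + b) = m (m + n) and 2 b (a - b) = n (m - n). *)
have [a [b [ba em en]]] : exists a b, [/\ b < a, m = a + b & n = a - b]%N.
  exists (m + n)./2, (m - n)./2; split; lia.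
have ab : odd a != odd b by move: mo; rewrite em oddD; case: (odd a); case: (odd b).
apply: (rank_ge1_opposite_parity 2 a b) => //.
  by rewrite -natrM em en; congr _%:R; nia.
rewrite -natrB ?(ltnW ba) // -!natrM em en; congr _%:R; nia.
Qed.
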